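(* Let $\theta>0$ be a real number, let $n_1,n_2,\ldots$ be a fixed sequence of integers with $n_i\ge 1$ for all $i\ge 1$, and let $(\tilde\Pi_t)_{t\ge 0}$ be the multiset Chinese restaurant process with parameter $\theta$ for this sequence. Then for every $t\ge 1$ and every permutation $\pi\in S(n_1,\ldots,n_t)$, $$\mathbb{P}(\tilde\Pi_t=\pi)=\frac{\theta^{|\pi|}}{S},$$ where $|\pi|$ is the number of cycles of $\pi$ and $$S=\sum_{\pi\in S(n_1,\ldots,n_t)}\theta^{|\pi|}=\prod_{s=1}^t F_s(\theta).$$
   Context: **Multiset permutations.** Let $n_1,n_2,\ldots\ge 1$ be integers. For $t\ge 1$, $M(n_1,\ldots,n_t)$ is the multiset containing $n_i$ copies of $i$ for each $i\in[t]=\{1,\ldots,t\}$; for $t=0$ it is empty. Elements are ordered as integers. Put $N_t=n_1+\cdots+n_t$, $N_0=0$. A permutation of a multiset is an arrangement of its elements in a row; $S(n_1,\ldots,n_t)$ is the set of permutations of $M(n_1,\ldots,n_t)$ (for $t=0$ it consists of the empty permutation only). In two-line notation, a permutation has as its top line the elements of the multiset in nondecreasing order and as its bottom line the arrangement. **Intercalation product.** For permutations $\pi_1,\pi_2$ of two multisets, $\pi_1\top\pi_2$ is the permutation of the multiset union (multiplicities added) obtained by juxtaposing the two-line notations of $\pi_1$ and $\pi_2$ (with $\pi_1$ on the left) and stably sorting the columns into nondecreasing order of the top line (columns with equal top entries keep their left-to-right order). **Cycles.** For possibly repeated elements $x_1,\ldots,x_m$, the cycle $(x_1\,x_2\ldots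 x_m)$ is the multiset permutation obtained by stably sorting by top entry the columns of the two-line array with top line $x_1,x_2,\ldots,x_m$ and bottom line $x_2,x_3,\ldots,x_m,x_1$. **Cycle factorisation (known theorem of Knuth).** Every nonempty multiset permutation $\pi$ has a unique representation $$\pi=(x_{1,1}\ldots x_{1,m_1}\,y_1)\top(x_{2,1}\ldots x_{2,m_2}\,y_2)\top\cdots\top(x_{\tau,1}\ldots x_{\tau,m_\tau}\,y_\tau),\qquad \tau\ge 1,\ m_i\ge 0,$$ with $y_1\le y_2\le\cdots\le y_\tau$ and $y_i<x_{i,j}$ for all $1\le j\le m_i$, $1\le i\le\tau$. The number of cycles of $\pi$ is $|\pi|=\tau$ (and $0$ for the empty permutation). **The multiset Chinese restaurant process (CRP).** For $\theta>0$ and $t\ge 1$ let $$F_t(\theta)=\sum_{k=0}^{n_t}\binom{N_{t-1}-1+n_t-k}{n_t-k}\theta^{k},$$ with the convention $\binom{-1}{0}=1$ and $\binom{-1}{k}=0$ for $k\ge 1$. The process is a Markov chain with $\tilde\Pi_0$ the empty permutation and $\tilde\Pi_t\in S(n_1,\ldots,n_t)$. Given $\tilde\Pi_{t-1}$, written in its unique cycle factorisation, step $t$ consists of choosing $k_t\in\{0,1,\ldots,n_t\}$, placing $k_t$ copies of $t$ in $k_t$ new singleton cycles $(t)$ appended at the right end of the factorisation, and inserting the remaining $n_t-k_t$ copies of $t$ inside the existing cycles, each immediately to the left of one of the $N_{t-1}$ elements (the $x_{i,j}$'s and $y_i$'s) of the factorisation of $\tilde\Pi_{t-1}$. Several copies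 may be inserted to the left of the same element, so an insertion is specified by a vector of $N_{t-1}$ nonnegative integers summing to $n_t-k_t$, and there are $\binom{N_{t-1}-1+n_t-k_t}{n_t-k_t}$ of them. Each specific choice of $k_t$ together with a specific insertion of the other $n_t-k_t$ copies is made with probability $\theta^{k_t}/F_t(\theta)$. The result is the cycle factorisation of $\tilde\Pi_t$. *)

(* Defs.v *)
From HB Require Import structures.
From mathcomp Require Import all_boot all_order all_algebra.
From mathcomp Require Import all_classical all_reals all_analysis.

Set Implicit Arguments.
Unset Strict Implicit.
Unset Printing Implicit Defensive.

Import Order.TTheory GRing.Theory Num.Theory.

Local Open Scope classical_set_scope.
Local Open Scope ring_scope.

(* A permutation of a multiset of integers is the word [w : seq nat] on the
   bottom line of its two-line notation.  The sequence n_1, n_2, ... is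
   [n : nat -> nat]; the value [n 0] is never used. *)

Definition msum (n : nat -> nat) (t : nat) : nat :=
  (\sum_(1 <= i < t.+1) n i)%N.

Definition mset (n : nat -> nat) (t : nat) : seq nat :=
  flatten [seq nseq (n i) i | i <- iota 1 t].

(* [permutations] is duplicate-free, and [w \in permutations s] is equivalent
   to [perm_eq w s]. *)
Definition mperms (n : nat -> nat) (t : nat) : seq (seq nat) :=
  permutations (mset n t).

(* Columns are pairs (top, bottom); [sort] is a stable sort. *)
Definition sort_cols (cols : seq (nat * nat)) : seq (nat * nat) :=
  sort (fun c d : nat * nat => c.1 <= d.1)%N cols.

Definition two_line (w : seq nat) : seq (nat * nat) := zip (sort leq w) w.

Definition intercal (w1 w2 : seq nat) : seq nat :=
  unzip2 (sort_cols (two_line w1 ++ two_line w2)).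

Definition mcycle (x : seq nat) : seq nat :=
  unzip2 (sort_cols (zip x (rot 1 x))).

(* The pair (x, y) stands for the cycle (x_1 ... x_m y). *)
Definition cyc : Type := (seq nat * nat)%type.

Definition cyc_elts (c : cyc) : seq nat := rcons c.1 c.2.

(* The empty permutation is a two-sided unit for [intercal] (on words), so the
   initial value of the fold does not contribute. *)
Definition cyc_prod (cs : seq cyc) : seq nat :=
  foldr intercal [::] [seq mcycle (cyc_elts c) | c <- cs].

Definition factorises (w : seq nat) (cs : seq cyc) : Prop :=
  [/\ sorted leq [seq c.2 | c <- cs],
      (forall c, c \in cs -> forall x, x \in c.1 -> (c.2 < x)%N)
    & cyc_prod cs = w].

(* The unique cycle factorisation of [w], selected by choice; that of the empty
   permutation is the empty list. *)
Definition cyc_fact (w : seq nat) : seq cyc :=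
  xget [::] [set cs : seq cyc | factorises w cs].

Definition ncycles (w : seq nat) : nat := size (cyc_fact w).

(* Inserts [nth 0 v i] copies of [t] immediately to the left of the [i]-th
   element of [cyc_elts c]; [v] has length [(size c.1).+1], its last entry being
   the number of copies placed before [c.2]. *)
Definition insert_cyc (t : nat) (c : cyc) (v : seq nat) : cyc :=
  (flatten [seq rcons (nseq p.1 t) p.2 | p <- zip v c.1] ++ nseq (last 0%N v) t,
   c.2).

(* [v] is indexed by all the elements of the factorisation, read from left to
   right; [reshape] cuts it into one block per cycle. *)
Definition insert_cycs (t : nat) (cs : seq cyc) (v : seq nat) : seq cyc :=
  [seq insert_cyc t p.1 p.2
     | p <- zip cs (reshape [seq size (cyc_elts c) | c <- cs] v)].

Definition crp_step (t k : nat) (v : seq nat) (w : seq nat) : seq nat :=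
  cyc_prod (insert_cycs t (cyc_fact w) v ++ nseq k ([::], t)).

(* With j = n_t - k, the coefficient 'C((N_{t-1} + j).-1, j) is
   binom(N_{t-1} - 1 + j, j); when N_{t-1} = 0 the truncated predecessor makes
   it 1 for j = 0 and 0 for j >= 1. *)
Definition crpF (R : realType) (theta : R) (n : nat -> nat) (t : nat) : R :=
  \sum_(0 <= k < (n t).+1)
     'C((msum n t.-1 + (n t - k)).-1, n t - k)%:R * theta ^+ k.

(* Transition probability of step t >= 1 from [w] to [w']: the total probability
   of the choices (k, v) leading from [w] to [w'].  The entries of [v] sum to
   n_t - k, so bounding each of them by n_t is no restriction. *)
Definition crp_kernel (R : realType) (theta : R) (n : nat -> nat) (t : nat)
    (w w' : seq nat) : R :=
  \sum_(k < (n t).+1)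
    \sum_(v : (msum n t.-1).-tuple 'I_(n t).+1 |
            (sumn (map val v) == n t - k)%N
            && (crp_step t k (map val v) w == w'))
       theta ^+ k / crpF theta n t.

(* The Markov property is stated in product form, which avoids conditioning on
   histories of probability zero. *)
Record is_crp (R : realType) (theta : R) (n : nat -> nat)
    (d : measure_display) (T : measurableType d)
    (P : probability T R) (X : nat -> T -> seq nat) : Prop := IsCRP {
  crp_measurable : forall t w, measurable (X t @^-1` [set w]);
  crp_init : forall o, X 0%N o = [::];
  crp_range : forall t o, X t o \in mperms n t;
  crp_markov : forall (t : nat) (h : nat -> seq nat) (w : seq nat),
    P [set o | (forall s, (s <= t)%N -> X s o = h s) /\ X t.+1 o = w] =
    (P [set o | forall s, (s <= t)%N -> X s o = h s]
       * (crp_kernel theta n t.+1 (h t) w)%:E)%E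
}.

(* Main.v *)
(** Record a multiset permutation by its rows: for each letter [a], the bottom
    entries under the occurrences of [a] in the top line, in order.  The
    intercalation product concatenates rows, so a word is the product of given
    cycles exactly when its rows are the concatenated rows of these cycles.  In a
    factorisation y_1 is the least letter, and the first cycle is the trail that
    leaves y_1 and always follows the first unused entry of the current row until
    it returns to y_1; deleting it and iterating gives existence and uniqueness.

    A factorisation over letters at most t arises from exactly one factorisation
    over letters below t by exactly one choice (k, v): the cycles (t) come last
    and give k, the gaps between the other letters give v, and erasing t gives the
    previous factorisation.  Since a step adds k cycles, the kernel maps the
    weights theta^|w| on S(n_1, ..., n_t) to the weights theta^|w'| / F_(t+1) on
    S(n_1, ..., n_(t+1)); both claims follow by induction on t. *)

Require Import Defs.
From HB Require Import structures.
From mathcomp Require Import all_boot all_order all_algebra.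
From mathcomp Require Import all_classical all_reals all_analysis.
From mathcomp Require Import zify.

Set Implicit Arguments.
Unset Strict Implicit.
Unset Printing Implicit Defensive.

Import Order.TTheory GRing.Theory Num.Theory.

(** * Column arrays, their rows and stable sorting *)

(** Stable sorting by top entry keeps exactly this information, and on it the intercalation product
    acts as plain concatenation. *)
Definition same_rows (A B : seq (nat * nat)) : Prop :=
  forall a, [seq c <- A | c.1 == a] = [seq c <- B | c.1 == a].

Lemma same_rows_sym A B : same_rows A B -> same_rows B A.
Proof. by move=> AB a; rewrite AB. Qed.

Lemma same_rows_trans A B C : same_rows A B -> same_rows B C -> same_rows A C.
Proof. by move=> AB BC a; rewrite AB. Qed.

Lemma same_rows_cat A A' B B' :
  same_rows A A' -> same_rows B B' -> same_rows (A ++ B) (A' ++ B').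
Proof. by move=> AA BB a; rewrite !filter_cat AA BB. Qed.

Lemma same_rows_perm A B : same_rows A B -> perm_eq A B.
Proof.
move=> AB; apply/allP => p _ /=; apply/eqP.
have H C : count_mem p C = count_mem p [seq c <- C | c.1 == p.1].
  rewrite count_filter; apply: eq_count => q /=.
  by case: (q =P p) => // ->; rewrite eqxx.
by rewrite H AB -H.
Qed.

Lemma same_rows_cons p q A B : p.1 = q.1 ->
  same_rows (p :: A) (q :: B) -> p = q /\ same_rows A B.
Proof.
move=> pq AB; have := AB p.1; rewrite /= pq eqxx => -[pq' _].
split=> // a; have := AB a; rewrite /= pq.
by case: ifP => // _ [].
Qed.

Lemma perm_sort_cols A : perm_eq (sort_cols A) A.
Proof. exact/permPl/perm_sort. Qed.

Lemma same_rows_sort_cols A : same_rows (sort_cols A) A.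
Proof.
move=> a; rewrite /sort_cols filter_sort.
- apply: (@sorted_sort_in _ (fun c : nat * nat => c.1 == a)).
  + by move=> p q r _ _ _; apply: leq_trans.
  + exact: filter_all.
  + elim: A => //= p A; case: ifP => //= /eqP pa.
    by case: [seq _ <- _ | _] (filter_all (fun c : nat * nat => c.1 == a) A)
      => //= q ? /andP[/eqP -> _]; rewrite pa leqnn.
- by move=> p q; apply: leq_total.
- by move=> p q r; apply: leq_trans.
Qed.

(** Each sorted array begins with a column of least top entry. Equal rows force the same least top
    and the same first column of its row; peeling this column off allows induction. *)
Lemma sort_cols_eq A B : same_rows A B -> sort_cols A = sort_cols B.
Proof.
have key_tr : transitive (fun c d : nat * nat => c.1 <= d.1).
  by move=> p q r; apply: leq_trans.
have srt C : sorted (fun c d : nat * nat => c.1 <= d.1) (sort_cols C).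
  by apply: sort_sorted => p q; apply: leq_total.
move=> AB; have {AB} : same_rows (sort_cols A) (sort_cols B).
  apply: same_rows_trans (same_rows_sort_cols A) _.
  exact: same_rows_trans AB (same_rows_sym (same_rows_sort_cols B)).
elim: (sort_cols A) (sort_cols B) (srt A) (srt B) => [|p S IH] [|q S'] //=.
- by move=> _ _ /(_ q.1); rewrite /= eqxx.
- by move=> _ _ /(_ p.1); rewrite /= eqxx.
move=> pS qS' SS; have pSS := perm_mem (same_rows_perm SS).
have pq : p.1 = q.1.
  apply/eqP; rewrite eqn_leq; apply/andP; split.
    have := pSS q; rewrite !inE eqxx /= => /orP[/eqP -> //|].
    exact: (allP (order_path_min key_tr pS)).
  have := pSS p; rewrite !inE eqxx /= => /esym /orP[/eqP -> //|].
  exact: (allP (order_path_min key_tr qS')).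
have [-> SS'] := same_rows_cons pq SS; congr (_ :: _).
by apply: IH SS'; [exact: path_sorted pS | exact: path_sorted qS'].
Qed.

(** Balance makes the sorted top line the nondecreasing rearrangement of the bottom line, so the
    bottom line alone recovers the whole array. *)
Lemma two_line_sort_cols E : perm_eq (unzip1 E) (unzip2 E) ->
  two_line (unzip2 (sort_cols E)) = sort_cols E.
Proof.
move=> bal; rewrite /two_line.
suff -> : sort leq (unzip2 (sort_cols E)) = unzip1 (sort_cols E).
  exact: zip_unzip.
apply: (sorted_eq leq_trans anti_leq); first exact: (sort_sorted leq_total).
  rewrite sorted_map; apply: sort_sorted => p q; exact: leq_total.
rewrite perm_sort; have pE := perm_sort_cols E.
rewrite (permPl (perm_map _ pE)) perm_sym.
by rewrite (permPl (perm_map _ pE)).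
Qed.

(** * Columns of a factorisation and the product of its cycles *)

Definition cyc_cols (c : cyc) : seq (nat * nat) :=
  zip (cyc_elts c) (rot 1 (cyc_elts c)).

Definition fact_cols (cs : seq cyc) : seq (nat * nat) :=
  flatten [seq cyc_cols c | c <- cs].

Definition fact_elts (cs : seq cyc) : seq nat :=
  flatten [seq cyc_elts c | c <- cs].

Lemma unzip1_fact_cols cs : unzip1 (fact_cols cs) = fact_elts cs.
Proof.
elim: cs => //= c cs IH; rewrite /fact_cols /= /unzip1 map_cat.
by rewrite [map fst _]unzip1_zip ?size_rot // [X in _ ++ X]IH.
Qed.

Lemma perm_unzip2_fact_cols cs : perm_eq (unzip2 (fact_cols cs)) (fact_elts cs).
Proof.
elim: cs => //= c cs IH; rewrite /fact_cols /= /unzip2 map_cat.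
rewrite [map snd _]unzip2_zip ?size_rot //; apply: perm_cat => //.
by rewrite perm_rot.
Qed.

Lemma fact_cols_balanced cs :
  perm_eq (unzip1 (fact_cols cs)) (unzip2 (fact_cols cs)).
Proof. by rewrite unzip1_fact_cols perm_sym perm_unzip2_fact_cols. Qed.

(** Sorting leaves the rows unchanged, so one sort at the end replaces the sorts after each
    intercalation. *)
Lemma cyc_prodE cs : cyc_prod cs = unzip2 (sort_cols (fact_cols cs)).
Proof.
elim: cs => //= c cs IH; rewrite /cyc_prod /= -/(cyc_prod cs) IH.
congr unzip2; rewrite /mcycle -/(cyc_cols c) !two_line_sort_cols.
- apply: sort_cols_eq; rewrite /fact_cols /=.
  by apply: same_rows_cat; exact: same_rows_sort_cols.
- exact: fact_cols_balanced.
- by have := fact_cols_balanced [:: c]; rewrite /fact_cols /= cats0.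
Qed.

Lemma perm_cyc_prod cs : perm_eq (cyc_prod cs) (fact_elts cs).
Proof.
rewrite cyc_prodE (permPl (perm_map _ (perm_sort_cols _))).
exact: perm_unzip2_fact_cols.
Qed.

Lemma two_line_cyc_prod cs : two_line (cyc_prod cs) = sort_cols (fact_cols cs).
Proof. by rewrite cyc_prodE two_line_sort_cols ?fact_cols_balanced. Qed.

Lemma cyc_prod_same_rows cs cs' :
  cyc_prod cs = cyc_prod cs' -> same_rows (fact_cols cs) (fact_cols cs').
Proof.
move=> eq_cs; have := congr1 two_line eq_cs; rewrite !two_line_cyc_prod => eqS.
apply: same_rows_trans (same_rows_sym (same_rows_sort_cols _)) _.
by rewrite eqS; exact: same_rows_sort_cols.
Qed.

(* The only column of top [y] in the cycle is the last one, so it can be moved to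
   the front without changing any row. *)
Lemma cyc_cols_trail s y : y \notin s ->
  same_rows (cyc_cols (s, y)) (zip (y :: s) (rcons s y)).
Proof.
rewrite /cyc_cols /cyc_elts /=; case: s => // x s ys.
rewrite rot1_cons zip_rcons ?size_rcons //.
have row_y : [seq c <- zip (x :: s) (rcons s y) | c.1 == y] = [::].
  apply/eqP; rewrite -[_ == _]negbK -has_filter.
  apply/hasPn => p pZ; apply: contraNneq ys => <-.
  have : p.1 \in unzip1 (zip (x :: s) (rcons s y)) by apply/mapP; exists p.
  by rewrite unzip1_zip // size_rcons.
move=> a; rewrite filter_rcons -[rcons (x :: s) y]/(x :: rcons s y).
rewrite -[zip (y :: _) _]/((y, x) :: zip (x :: s) (rcons s y)).
rewrite [RHS]/=; case: eqP => // <-.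
by move: row_y => /= ->.
Qed.

(** * Uniqueness of the cycle factorisation *)

(** The row of [a] determines the first column, which gives the next letter, and so on; as [y] lies
    in neither [s] nor [s'], both trails stop at the first arrival at [y]. *)
Lemma trail_inj y a s s' A B : y \notin s -> y \notin s' ->
  same_rows (zip (a :: s) (rcons s y) ++ A) (zip (a :: s') (rcons s' y) ++ B) ->
  s = s' /\ same_rows A B.
Proof.
elim: s a s' => [|b s IH] a [|b' s'] /= ys ys' /same_rows_cons-/(_ erefl).
- by case.
- by case=> -[yb]; rewrite yb inE eqxx in ys'.
- by case=> -[yb]; rewrite yb inE eqxx in ys.
case=> -[<-] rows; move: ys ys'; rewrite !inE !negb_or.
by case/andP=> _ ys /andP[_ ys']; have [-> rowsAB] := IH b s' ys ys' rows.
Qed.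

Definition fact_ok (cs : seq cyc) : bool :=
  sorted leq (unzip2 cs) && all (fun c : cyc => all (ltn c.2) c.1) cs.

Lemma fact_okP (cs : seq cyc) : reflect
  (sorted leq [seq c.2 | c <- cs] /\
   forall c, c \in cs -> forall x, x \in c.1 -> c.2 < x) (fact_ok cs).
Proof.
apply: (iffP andP) => -[srt lt_cs]; split=> //.
  by move=> c /(allP lt_cs) /allP.
by apply/allP => c /lt_cs lt_c; apply/allP.
Qed.

Lemma fact_ok_cons c cs : fact_ok (c :: cs) =
  [&& all (ltn c.2) c.1, all (fun d : cyc => c.2 <= d.2) cs & fact_ok cs].
Proof.
rewrite /fact_ok /= path_sortedE; last exact: leq_trans.
by rewrite all_map; case: (all _ c.1); rewrite ?andbF // -!andbA.
Qed.

Lemma fact_ok_min c cs : fact_ok (c :: cs) -> all (leq c.2) (fact_elts (c :: cs)).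
Proof.
elim: cs c => [|d cs IH] c; rewrite fact_ok_cons => /and3P[cc].
  rewrite /fact_elts /= cats0 /cyc_elts all_rcons leqnn => _ _ /=.
  by apply: sub_all cc => x; apply: ltnW.
case/andP=> cd _ /IH dcs; rewrite /fact_elts /= all_cat -/(fact_elts (d :: cs)).
rewrite /cyc_elts all_rcons leqnn (sub_all _ cc) /=; last by move=> x; apply: ltnW.
by apply: sub_all dcs => x; apply: leq_trans.
Qed.

Lemma fact_ok_notin c cs : fact_ok (c :: cs) -> c.2 \notin c.1.
Proof.
rewrite fact_ok_cons => /and3P[cc _ _]; apply/negP => /(allP cc) /=.
by rewrite ltnn.
Qed.

Lemma same_rows_elts cs cs' : same_rows (fact_cols cs) (fact_cols cs') ->
  perm_eq (fact_elts cs) (fact_elts cs').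
Proof. by move/same_rows_perm/(perm_map fst); rewrite -!unzip1_fact_cols. Qed.

Lemma fact_ok_inj cs cs' : fact_ok cs -> fact_ok cs' ->
  same_rows (fact_cols cs) (fact_cols cs') -> cs = cs'.
Proof.
have last_in c ds : c.2 \in fact_elts (c :: ds).
  by rewrite /fact_elts /= mem_cat /cyc_elts mem_rcons inE eqxx.
elim: cs cs' => [|c cs IH] [|c' cs'] // ok ok' rows.
- by have := perm_mem (same_rows_elts rows) c'.2; rewrite last_in.
- by have := perm_mem (same_rows_elts rows) c.2; rewrite last_in.
have eq_elts := perm_mem (same_rows_elts rows).
(* Both closing letters are the least letter of the same multiset. *)
have cc' : c.2 = c'.2.
  apply/eqP; rewrite eqn_leq; apply/andP; split.
    by apply: (allP (fact_ok_min ok)); rewrite eq_elts.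
  by apply: (allP (fact_ok_min ok')); rewrite -eq_elts.
(* With its last column moved to the front, the first cycle becomes a trail that [trail_inj] can
   compare. *)
have rowsE d ds : fact_ok (d :: ds) -> same_rows (fact_cols (d :: ds))
    (zip (d.2 :: d.1) (rcons d.1 d.2) ++ fact_cols ds).
  move=> okd; apply: same_rows_cat => //; case: d okd => s y okd.
  exact: cyc_cols_trail (fact_ok_notin okd).
have := same_rows_trans (same_rows_sym (rowsE _ _ ok)) rows.
move/same_rows_trans/(_ (rowsE _ _ ok')); rewrite -cc' => /trail_inj.
rewrite (fact_ok_notin ok) {1}cc' (fact_ok_notin ok') => /(_ isT isT)[c1 rows'].
have -> : c = c'.
  by case: c c' cc' c1 {rows IH ok ok' eq_elts rowsE} => ? ? [? ?] /= -> ->.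
congr (_ :: _); apply: IH => //; move: ok ok'; rewrite !fact_ok_cons.
  by case/and3P.
by move=> _ /and3P[].
Qed.

(** * Existence of the cycle factorisation *)

Lemma same_rows_extract a E : a \in unzip1 E ->
  exists b E', same_rows E ((a, b) :: E').
Proof.
elim: E => //= -[x b] E IH; rewrite inE; case: eqP => [->|ax] /=.
  by exists b, E.
move=> /IH[b' [E' rows]]; exists b', ((x, b) :: E') => a'.
rewrite /= rows /=; case: eqP => [<-|//].
by have /eqP/negPf-> := ax.
Qed.

(* The balance hypothesis says that the unused columns [E] have, at every
   letter, as many exits as entries, except for a trail still to be closed from
   [b] to [y]; so a walk standing at [b <> y] always finds an unused exit. *)
Lemma trail_exists y a b E : perm_eq (y :: unzip1 E) (b :: unzip2 E) ->
  exists s A, y \notin s /\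
    same_rows ((a, b) :: E) (zip (a :: s) (rcons s y) ++ A).
Proof.
have [m] := ubnP (size E); elim: m => // m IH in a b E *.
move=> szE bal; have [-> | yb] := eqVneq b y; first by exists [::], E.
have bE : b \in unzip1 E.
  by have := perm_mem bal b; rewrite !inE eqxx (negPf yb).
have [b' [E' rows]] := same_rows_extract bE.
have pE := same_rows_perm rows.
(* The walk leaves [b] by the column [(b, b')]; cancelling [b] on both sides of the balance of [E]
   gives that of [E']. *)
have [||s [A [ys rows']]] := IH b b' E'.
- by move: szE; rewrite (perm_size pE).
- rewrite -(perm_cons b).
  have /permPr <- : perm_eq (b :: unzip2 E) [:: b, b' & unzip2 E'].
    by rewrite perm_cons (perm_map snd pE).
  rewrite -(permPr bal) (permPl (permEl (perm_catCA [:: b] [:: y] _))) perm_cons.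
  by rewrite perm_sym (perm_map fst pE).
exists (b :: s), A; split; first by rewrite inE negb_or eq_sym yb.
move=> a'; rewrite /= -[zip _ _ ++ A]/(zip (b :: s) (rcons s y) ++ A).
by rewrite -[in RHS]rows' -rows.
Qed.

Lemma seq_min (s : seq nat) : s != [::] -> exists2 y, y \in s & all (leq y) s.
Proof.
case: s => // x s _; have ex : exists y, y \in x :: s by exists x; apply: mem_head.
case: (ex_minnP ex) => y ys y_min; exists y => //.
by apply/allP => z; apply: y_min.
Qed.

(** Strong induction on the number of columns: the trail from the least letter back to itself closes
    a cycle, and its removal keeps the balance. *)
Lemma fact_exists E : perm_eq (unzip1 E) (unzip2 E) ->
  exists2 cs, fact_ok cs & same_rows (fact_cols cs) E.
Proof.
have [m] := ubnP (size E); elim: m => // m IH in E *.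
move=> szE bal; have [E0 | /seq_min[y yE y_min]] := eqVneq (unzip1 E) [::].
  by exists [::] => //; case: E E0 {szE bal}.
have [b [E1 rows1]] := same_rows_extract yE.
have pE1 := same_rows_perm rows1.
have bal1 : perm_eq (y :: unzip1 E1) (b :: unzip2 E1).
  have /permPr <- := perm_map snd pE1; have /permPl <- := perm_map fst pE1.
  exact: bal.
have [s [A [ys rowsA]]] := trail_exists y bal1.
have {rows1} rows := same_rows_trans rows1 rowsA.
have pE := same_rows_perm rows.
have pE_fst : perm_eq (unzip1 E) (y :: s ++ unzip1 A).
  have /permPl -> := perm_map fst pE; rewrite map_cat [map fst (zip _ _)]unzip1_zip //.
  by rewrite size_rcons.
have pE_snd : perm_eq (unzip2 E) (y :: s ++ unzip2 A).
  have /permPl -> := perm_map snd pE; rewrite map_cat [map snd (zip _ _)]unzip2_zip.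
    by rewrite cat_rcons perm_catC /= perm_cons perm_catC.
  by rewrite size_rcons.
have [||cs ok rowscs] := IH A.
- rewrite -ltnS; apply: leq_trans szE; rewrite ltnS (perm_size pE) size_cat.
  by rewrite size_zip size_rcons minnn addSn ltnS leq_addl.
- move: bal; rewrite (permPl pE_fst) (permPr pE_snd).
  by rewrite perm_cons perm_cat2l.
have y_lt : all (ltn y) s.
  apply/allP => x xs; rewrite /= ltn_neqAle; apply/andP; split.
    by apply: contraNneq ys => ->.
  by apply: (allP y_min); rewrite (perm_mem pE_fst) inE mem_cat xs orbT.
exists ((s, y) :: cs).
  rewrite fact_ok_cons y_lt ok andbT /=; apply/allP => d d_cs /=.
  apply: (allP y_min); rewrite (perm_mem pE_fst) inE mem_cat.
  rewrite -(perm_mem (perm_map fst (same_rows_perm rowscs))).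
  rewrite [map fst _]unzip1_fact_cols; apply/orP; right; apply/orP; right.
  apply/flattenP; exists (cyc_elts d); first by apply/mapP; exists d.
  by rewrite /cyc_elts mem_rcons mem_head.
apply: same_rows_trans (same_rows_sym rows).
exact: same_rows_cat (cyc_cols_trail ys) rowscs.
Qed.

(** Existence ensures that the choice in [cyc_fact] never falls back on the default of [xget]. *)
Lemma cyc_factP w : fact_ok (cyc_fact w) /\ cyc_prod (cyc_fact w) = w.
Proof.
have bal : perm_eq (unzip1 (two_line w)) (unzip2 (two_line w)).
  by rewrite unzip1_zip ?unzip2_zip ?size_sort // perm_sort.
have [cs ok rows] := fact_exists bal.
suff /(xgetI [::])[srt lt_cs eq_w] : factorises w cs.
  by split=> //; apply/fact_okP.
case/fact_okP: (ok) => srt lt_cs; split=> //.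
(* The columns of [cs] sort to the same array as [two_line w], which is already sorted. *)
rewrite cyc_prodE (sort_cols_eq rows) /sort_cols sorted_sort.
- by rewrite [unzip2 _]unzip2_zip ?size_sort.
- by move=> p q r; apply: leq_trans.
- have : sorted leq (unzip1 (two_line w)).
    by rewrite unzip1_zip ?size_sort //; exact: (sort_sorted leq_total).
  by rewrite sorted_map.
Qed.

Lemma cyc_fact_ok w : fact_ok (cyc_fact w).
Proof. by case: (cyc_factP w). Qed.

Lemma cyc_factK w : cyc_prod (cyc_fact w) = w.
Proof. by case: (cyc_factP w). Qed.

Lemma cyc_prodK cs : fact_ok cs -> cyc_fact (cyc_prod cs) = cs.
Proof.
move=> ok; apply: fact_ok_inj (cyc_fact_ok _) ok _.
by apply: cyc_prod_same_rows; rewrite cyc_factK.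
Qed.

(** * Inserting and erasing a letter in one word *)

(** Here [x] is a cycle without its closing letter; the last entry of [v] counts the copies after
    [x], that is, just before the closing letter. *)
Definition insert_word (t : nat) (v x : seq nat) : seq nat :=
  flatten [seq rcons (nseq p.1 t) p.2 | p <- zip v x] ++ nseq (last 0 v) t.

(** Recovers the vector [v] of an insertion. The base case [[:: 0]] is the place after the last
    letter; each [t] read adds one to the gap currently at the head. *)
Fixpoint gaps (t : nat) (s : seq nat) : seq nat :=
  if s is x :: s' then
    if x == t then (head 0 (gaps t s')).+1 :: behead (gaps t s')
    else 0 :: gaps t s'
  else [:: 0].

Lemma gaps_nseq_cat t a s :
  gaps t (nseq a t ++ s) = (a + head 0 (gaps t s)) :: behead (gaps t s).
Proof.
elim: a => [|a IH] /=; last by rewrite eqxx IH.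
by case: s => //= x s; case: eqP.
Qed.

Lemma insert_word_cons t a v b x : size v = (size x).+1 ->
  insert_word t (a :: v) (b :: x) = nseq a t ++ b :: insert_word t v x.
Proof.
by case: v => // a' v _; rewrite /insert_word /= -catA cat_rcons.
Qed.

Lemma gaps_insert_word t v x : size v = (size x).+1 -> t \notin x ->
  gaps t (insert_word t v x) = v.
Proof.
elim: x v => [|b x IH] [|a v] //=.
  by case: v => // _ _; rewrite /insert_word /= -[nseq a t]cats0 gaps_nseq_cat /= addn0.
case=> szv; rewrite inE negb_or => /andP[tb tx].
by rewrite insert_word_cons // gaps_nseq_cat /= eq_sym (negPf tb) /= addn0 IH.
Qed.

Lemma strip_insert_word t v x : size v = (size x).+1 -> t \notin x ->
  [seq y <- insert_word t v x | y != t] = x.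
Proof.
elim: x v => [|b x IH] [|a v] //=.
  by case: v => // _ _; rewrite /insert_word /= filter_nseq eqxx.
case=> szv; rewrite inE negb_or => /andP[tb tx].
by rewrite insert_word_cons // filter_cat filter_nseq eqxx /= eq_sym tb IH.
Qed.

Lemma size_gaps t s : size (gaps t s) = (size [seq y <- s | y != t]).+1.
Proof.
elim: s => //= x s IH; case: eqP => //= _; last by rewrite IH.
by rewrite -IH; case: (gaps t s) IH.
Qed.

Lemma insert_gaps t s : insert_word t (gaps t s) [seq y <- s | y != t] = s.
Proof.
elim: s => //= x s IH; case: eqP => [->|_] /=.
  rewrite -[in RHS]IH; have := size_gaps t s.
  by case: (gaps t s) => // a v; case: [seq _ <- _ | _] v => [|y z] [|b v].
by rewrite insert_word_cons ?size_gaps // IH.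
Qed.

Lemma perm_insert_word t v x : size v = (size x).+1 ->
  perm_eq (insert_word t v x) (nseq (sumn v) t ++ x).
Proof.
elim: x v => [|b x IH] [|a v] //=.
  by case: v => // _; rewrite /insert_word /= addn0 cats0.
case=> szv; rewrite insert_word_cons // nseqD -catA perm_cat2l.
rewrite perm_sym -(cat1s b x) perm_catCA /= perm_cons perm_sym; exact: IH.
Qed.

(** * One step and its inverse on factorisations *)

Definition step_cycs (t k : nat) (v : seq nat) (cs : seq cyc) : seq cyc :=
  insert_cycs t cs v ++ nseq k ([::], t).

(** Undoing a step: in a valid factorisation over letters at most [t], the cycles closed by [t] are
    the new singletons. This gives the earlier factorisation; [gaps_cycs] and [new_cycs] give the
    choice made. *)
Definition strip_cycs (t : nat) (cs : seq cyc) : seq cyc :=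
  [seq ([seq x <- c.1 | x != t], c.2) | c <- cs & c.2 != t].

Definition gaps_cycs (t : nat) (cs : seq cyc) : seq nat :=
  flatten [seq gaps t c.1 | c <- cs & c.2 != t].

Definition new_cycs (t : nat) (cs : seq cyc) : nat :=
  count (fun c : cyc => c.2 == t) cs.

Lemma strip_cycs_cons t c cs : strip_cycs t (c :: cs) =
  if c.2 != t then ([seq x <- c.1 | x != t], c.2) :: strip_cycs t cs
  else strip_cycs t cs.
Proof. by rewrite /strip_cycs /=; case: ifP. Qed.

Lemma gaps_cycs_cons t c cs : gaps_cycs t (c :: cs) =
  if c.2 != t then gaps t c.1 ++ gaps_cycs t cs else gaps_cycs t cs.
Proof. by rewrite /gaps_cycs /=; case: ifP. Qed.

Lemma new_cycs_cons t c cs :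
  new_cycs t (c :: cs) = (c.2 == t) + new_cycs t cs.
Proof. by []. Qed.

Lemma step_cycs_cons t k v c cs : step_cycs t k v (c :: cs) =
  (insert_word t (take (size c.1).+1 v) c.1, c.2)
    :: step_cycs t k (drop (size c.1).+1 v) cs.
Proof. by rewrite /step_cycs /insert_cycs /= /cyc_elts size_rcons. Qed.

Lemma fact_elts_cons c cs : fact_elts (c :: cs) = c.1 ++ c.2 :: fact_elts cs.
Proof. by rewrite /fact_elts /= /cyc_elts cat_rcons. Qed.

Lemma fact_elts_nseq k t : fact_elts (nseq k ([::], t)) = nseq k t.
Proof. by elim: k => //= k IH; rewrite fact_elts_cons IH. Qed.

Lemma size_take_cyc c cs (v : seq nat) : size v = size (fact_elts (c :: cs)) ->
  size (take (size c.1).+1 v) = (size c.1).+1 /\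
  size (drop (size c.1).+1 v) = size (fact_elts cs).
Proof.
rewrite fact_elts_cons size_cat /= => szv; rewrite size_drop size_takel szv.
  by split=> //; rewrite addnS -addSn addKn.
by rewrite addnS ltnS leq_addr.
Qed.

Lemma perm_step_cycs t k v cs : size v = size (fact_elts cs) ->
  perm_eq (fact_elts (step_cycs t k v cs)) (fact_elts cs ++ nseq (sumn v + k) t).
Proof.
elim: cs v => [|c cs IH] v.
  by case: v => // _; rewrite /step_cycs /= fact_elts_nseq.
move=> szv; have [szt szd] := size_take_cyc szv.
apply/permP => p; rewrite step_cycs_cons !fact_elts_cons /=.
have /permP/(_ p) := perm_insert_word t szt; have /permP/(_ p) := IH _ szd.
have -> : sumn v = sumn (take (size c.1).+1 v) + sumn (drop (size c.1).+1 v).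
  by rewrite -sumn_cat cat_take_drop.
by rewrite !count_cat /= ?count_cat !count_nseq !mulnDr; lia.
Qed.

Lemma unzip2_step_cycs t k v cs :
  unzip2 (step_cycs t k v cs) = unzip2 cs ++ nseq k t.
Proof.
elim: cs v => [|c cs IH] v; first by rewrite /step_cycs /unzip2 /= map_nseq.
by rewrite step_cycs_cons /= IH.
Qed.

(** Inserted copies of [t] exceed every closing letter, and the new singletons, closed by the
    largest letter, belong at the right end. *)
Lemma step_cycs_ok t k v cs : fact_ok cs -> all (gtn t) (fact_elts cs) ->
  size v = size (fact_elts cs) -> fact_ok (step_cycs t k v cs).
Proof.
elim: cs v => [|c cs IH] v.
  move=> _ _; case: v => // _; rewrite /step_cycs /=.
  elim: k => //= k IH; rewrite fact_ok_cons IH /= andbT.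
  by apply/allP => d /nseqP[->] /=.
rewrite fact_ok_cons fact_elts_cons all_cat /= -fact_elts_cons.
case/and3P=> cc ccs ok /and3P[c1t c2t cst] szv.
have [szt szd] := size_take_cyc szv.
rewrite step_cycs_cons fact_ok_cons IH // andbT; apply/andP; split=> /=.
  rewrite (perm_all _ (perm_insert_word t szt)) all_cat cc andbT.
  by apply/allP => x /nseqP[-> _].
rewrite -(all_map snd (leq c.2)) [map snd _]unzip2_step_cycs all_cat.
  rewrite [all _ (unzip2 _)]all_map ccs /=.
by apply/allP => x /nseqP[-> _]; apply: ltnW.
Qed.

(** The letters of [cs] are all below [t], so every [t] present after the step was put there by
    it. *)
Lemma step_cycsK t k v cs : all (gtn t) (fact_elts cs) ->
  size v = size (fact_elts cs) ->
  [/\ strip_cycs t (step_cycs t k v cs) = cs,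
      gaps_cycs t (step_cycs t k v cs) = v
    & new_cycs t (step_cycs t k v cs) = k].
Proof.
elim: cs v => [|c cs IH] v.
  case: v => // _ _; rewrite /step_cycs /= /strip_cycs /gaps_cycs /new_cycs.
  have -> : [seq c <- nseq k ([::], t) | c.2 != t] = [::] :> seq cyc.
    by rewrite filter_nseq /= eqxx.
  by rewrite count_nseq /= eqxx mul1n.
rewrite {1}fact_elts_cons all_cat => /andP[c1t /andP[c2t cst]] szv.
have [szt szd] := size_take_cyc szv.
have tc1 : t \notin c.1 by apply/negP => /(allP c1t) /=; rewrite ltnn.
have tc2 : c.2 != t by rewrite neq_ltn [_ < _]c2t.
have [es eg en] := IH _ cst szd.
rewrite step_cycs_cons strip_cycs_cons gaps_cycs_cons new_cycs_cons tc2 (negPf tc2).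
rewrite es eg en strip_insert_word // gaps_insert_word // cat_take_drop.
by split=> //; case: (c).
Qed.

Lemma size_gaps_cycs t cs : size (gaps_cycs t cs) = size (fact_elts (strip_cycs t cs)).
Proof.
elim: cs => // c cs IH.
rewrite gaps_cycs_cons strip_cycs_cons; case: ifP => // _.
by rewrite fact_elts_cons !size_cat IH size_gaps /= addnS addSn.
Qed.

(** Any further letter in a cycle closed by [t] would exceed [t], against the bound. *)
Lemma new_cycs_top t cs : fact_ok cs -> all (geq t) (fact_elts cs) ->
  all (fun c : cyc => c.2 == t) cs -> cs = nseq (size cs) ([::], t).
Proof.
elim: cs => //= c cs IH; rewrite fact_ok_cons fact_elts_cons all_cat /=.
case/and3P=> cc _ ok /and3P[c1 _ cst] /andP[/eqP ct tt].
rewrite -IH //; congr (_ :: _); case: c cc c1 ct => [[|x s] y] /=.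
  by move=> _ _ ->.
case/andP=> yx _ /andP[xt _] yt.
by move: (leq_trans yx xt); rewrite yt ltnn.
Qed.

Lemma unstep_cycsK t cs : fact_ok cs -> all (geq t) (fact_elts cs) ->
  step_cycs t (new_cycs t cs) (gaps_cycs t cs) (strip_cycs t cs) = cs.
Proof.
elim: cs => // c cs IH ok cst.
have [ct | ct] := eqVneq c.2 t.
  (* A cycle closed by the largest letter forces all later ones to be closed by it, so only
     singletons remain. *)
  have tt : all (fun d : cyc => d.2 == t) (c :: cs).
    rewrite /= ct eqxx; apply/allP => d d_cs; rewrite eqn_leq; apply/andP; split.
      apply: (allP cst); apply/flattenP; exists (cyc_elts d).
        by apply: map_f; rewrite inE d_cs orbT.
      by rewrite /cyc_elts mem_rcons mem_head.
    by move: ok; rewrite fact_ok_cons ct => /and3P[_ /allP/(_ _ d_cs)].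
  rewrite /step_cycs /strip_cycs /gaps_cycs /new_cycs.
  have -> : [seq d <- c :: cs | d.2 != t] = [::].
    by apply/eqP; rewrite -[_ == _]negbK -has_filter has_predC tt.
  by move: (tt); rewrite all_count => /eqP ->; rewrite [RHS](new_cycs_top ok cst tt).
have okcs : fact_ok cs by move: ok; rewrite fact_ok_cons => /and3P[].
have {}cst : all (geq t) (fact_elts cs).
  by move: cst; rewrite fact_elts_cons all_cat => /and3P[].
rewrite strip_cycs_cons gaps_cycs_cons new_cycs_cons ct (negPf ct) step_cycs_cons.
rewrite [size _]/=.
rewrite -(size_gaps t) take_size_cat // drop_size_cat //.
by rewrite insert_gaps [X in _ :: X]IH //; case: (c).
Qed.

Lemma fact_elts_strip t cs : all (geq t) (fact_elts cs) ->
  all (gtn t) (fact_elts (strip_cycs t cs)).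
Proof.
elim: cs => //= c cs IH; rewrite fact_elts_cons all_cat /=.
case/and3P=> c1t c2t cst; rewrite strip_cycs_cons; case: ifP => c2; last exact: IH.
rewrite fact_elts_cons all_cat; apply/andP; split; last first.
  by rewrite /= ltn_neqAle c2 c2t IH.
apply/allP => x; rewrite mem_filter => /andP[xt /(allP c1t) /=].
by rewrite ltn_neqAle xt.
Qed.

Lemma strip_cycs_ok t cs : fact_ok cs -> fact_ok (strip_cycs t cs).
Proof.
elim: cs => //= c cs IH; rewrite fact_ok_cons => /and3P[cc ccs /IH ok].
rewrite strip_cycs_cons; case: ifP => //= _; rewrite fact_ok_cons ok andbT /=.
apply/andP; split; first by apply/allP => x; rewrite mem_filter => /andP[_ /(allP cc)].
by rewrite all_map; apply/allP => d; rewrite mem_filter => /andP[_ /(allP ccs)].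
Qed.

(** * The step as a bijection on multiset permutations *)

Lemma msetS (n : nat -> nat) t : Defs.mset n t.+1 = Defs.mset n t ++ nseq (n t.+1) t.+1.
Proof. by rewrite /Defs.mset -(addn1 t) iotaD map_cat flatten_cat /= cats0 add1n addn1. Qed.

Lemma size_mset (n : nat -> nat) t : size (Defs.mset n t) = Defs.msum n t.
Proof.
elim: t => [|t IH]; first by rewrite /Defs.msum big_geq.
by rewrite msetS size_cat IH size_nseq /Defs.msum [RHS]big_nat_recr.
Qed.

Lemma mset_lt (n : nat -> nat) t : all (gtn t.+1) (Defs.mset n t).
Proof.
elim: t => // t IH; rewrite msetS all_cat; apply/andP; split.
  by apply: sub_all IH => x /ltnW.
by apply/allP => x /nseqP[->] /=.
Qed.

Lemma mpermsP (n : nat -> nat) t w : reflect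
  (perm_eq (fact_elts (cyc_fact w)) (Defs.mset n t)) (w \in mperms n t).
Proof.
rewrite mem_permutations; have := perm_cyc_prod (cyc_fact w).
by rewrite cyc_factK => /permPl ->; apply: idP.
Qed.

Lemma mperms_lt (n : nat -> nat) t w : w \in mperms n t ->
  all (gtn t.+1) (fact_elts (cyc_fact w)).
Proof. by move/mpermsP => /perm_all ->; apply: mset_lt. Qed.

Lemma mperms_size (n : nat -> nat) t w : w \in mperms n t ->
  size (fact_elts (cyc_fact w)) = Defs.msum n t.
Proof. by move/mpermsP => /perm_size ->; apply: size_mset. Qed.

(** The list built by the step is already a valid factorisation, so by uniqueness factoring its
    product returns it. *)
Lemma cyc_fact_crp_step (n : nat -> nat) t k v w :
  w \in mperms n t -> size v = Defs.msum n t ->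
  cyc_fact (crp_step t.+1 k v w) = step_cycs t.+1 k v (cyc_fact w).
Proof.
move=> wS szv; rewrite /crp_step -/(step_cycs _ _ _ _) cyc_prodK //.
apply: step_cycs_ok; rewrite ?(mperms_size wS) ?cyc_fact_ok //.
exact: mperms_lt wS.
Qed.

Lemma ncycles_crp_step (n : nat -> nat) t k v w :
  w \in mperms n t -> size v = Defs.msum n t ->
  ncycles (crp_step t.+1 k v w) = ncycles w + k.
Proof.
move=> wS szv; rewrite /ncycles (cyc_fact_crp_step k wS szv) -(size_map snd).
by rewrite [map snd _]unzip2_step_cycs size_cat size_map size_nseq.
Qed.

Lemma crp_step_mperms (n : nat -> nat) t k v w :
  w \in mperms n t -> size v = Defs.msum n t ->
  sumn v + k = n t.+1 -> crp_step t.+1 k v w \in mperms n t.+1.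
Proof.
move=> wS szv sumv; apply/mpermsP; rewrite (cyc_fact_crp_step k wS szv).
rewrite (permPl (perm_step_cycs _ _ _)) ?(mperms_size wS) // sumv msetS.
by rewrite perm_cat2r; apply/mpermsP.
Qed.

Lemma crp_step_inj (n : nat -> nat) t k k' v v' w w' :
  w \in mperms n t -> w' \in mperms n t ->
  size v = Defs.msum n t -> size v' = Defs.msum n t ->
  crp_step t.+1 k v w = crp_step t.+1 k' v' w' -> [/\ w = w', k = k' & v = v'].
Proof.
move=> wS wS' szv szv' /(congr1 cyc_fact).
rewrite (cyc_fact_crp_step k wS szv) (cyc_fact_crp_step k' wS' szv') => e.
have [||es eg en] := @step_cycsK t.+1 k v (cyc_fact w).
- exact: mperms_lt wS.
- by rewrite (mperms_size wS).
have [||es' eg' en'] := @step_cycsK t.+1 k' v' (cyc_fact w').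
- exact: mperms_lt wS'.
- by rewrite (mperms_size wS').
split; last 2 first.
- by rewrite -en -en' e.
- by rewrite -eg -eg' e.
by rewrite -(cyc_factK w) -(cyc_factK w') -es -es' e.
Qed.

Lemma crp_step_surj (n : nat -> nat) t w' : w' \in mperms n t.+1 ->
  exists w k v, [/\ w \in mperms n t, size v = Defs.msum n t, sumn v + k = n t.+1
    & crp_step t.+1 k v w = w'].
Proof.
move=> wS'; pose cs := cyc_fact w'; have pcs := mpermsP _ _ _ wS'.
have cst : all (geq t.+1) (fact_elts cs).
  by rewrite (perm_all _ pcs); exact: (mset_lt n t.+1).
have csK := unstep_cycsK (cyc_fact_ok w') cst.
have stripK := cyc_prodK (strip_cycs_ok t.+1 (cyc_fact_ok w')).
have szg := size_gaps_cycs t.+1 cs.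
have pm := perm_step_cycs t.+1 (new_cycs t.+1 cs) szg.
rewrite csK (permPl pcs) msetS in pm.
have notin s : all (gtn t.+1) s -> count_mem t.+1 s = 0.
  by move=> s_lt; apply/count_memPn/negP => /(allP s_lt) /=; rewrite ltnn.
(* Multiplicities of [t.+1] are compared; the stripped factorisation and [mset n t] contain none. *)
have sumg : sumn (gaps_cycs t.+1 cs) + new_cycs t.+1 cs = n t.+1.
  have /permP/(_ (pred1 t.+1)) := pm; rewrite !count_cat !count_nseq /= eqxx !mul1n.
  by rewrite !notin ?mset_lt ?fact_elts_strip.
exists (cyc_prod (strip_cycs t.+1 cs)), (new_cycs t.+1 cs), (gaps_cycs t.+1 cs).
have wS : cyc_prod (strip_cycs t.+1 cs) \in mperms n t.
  apply/mpermsP; rewrite stripK; move: pm; rewrite sumg perm_cat2r.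
  by rewrite perm_sym.
split=> //; first by rewrite szg -(mperms_size wS) stripK.
by rewrite /crp_step stripK -/(step_cycs _ _ _ _) csK cyc_factK.
Qed.

(** * Counting insertions and summing the kernel *)

Lemma leq_sumn (s : seq nat) x : x \in s -> x <= sumn s.
Proof.
elim: s => //= y s IH; rewrite inE => /orP[/eqP -> | /IH xs].
  exact: leq_addr.
exact: leq_trans xs (leq_addl _ _).
Qed.

Lemma exists_bounded_tuple m N (v : seq nat) : size v = m -> sumn v <= N ->
  exists u : m.-tuple 'I_N.+1, map val u = v.
Proof.
move=> /eqP szv vN; exists (map_tuple inord (Tuple szv)) => /=.
rewrite -map_comp -[RHS]map_id; apply/eq_in_map => x xv /=.
by rewrite inordK // ltnS (leq_trans (leq_sumn xv)).
Qed.

(** Stars and bars. Entries of a vector with sum [j] are at most [j], so the bound [N] may be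
    lowered to [j], where [card_ord_partitions] applies. *)
Lemma card_bounded_compositions m j N : j <= N ->
  #|[pred u : m.-tuple 'I_N.+1 | sumn (map val u) == j]| = 'C((m + j).-1, j).
Proof.
move=> jN.
have -> : #|[pred u : m.-tuple 'I_N.+1 | sumn (map val u) == j]|
    = #|[pred u : m.-tuple 'I_j.+1 | sumn (map val u) == j]|.
  pose f (u : m.-tuple 'I_j.+1) := map_tuple (widen_ord (jN : j.+1 <= N.+1)) u.
  have fE u : map val (f u) = map val u.
    by rewrite /= -map_comp; apply: eq_map => i.
  have f_inj : injective f.
    move=> u u' fu; apply/val_inj/(inj_map val_inj).
    by rewrite -!fE fu.
  rewrite -(fintype.card_image f_inj); apply: eq_card => u; rewrite !inE.
  apply/idP/fintype.imageP => [/eqP uj | [u' + ->]]; last by rewrite inE fE.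
  have [||u' u'E] := @exists_bounded_tuple m j (map val u).
  - by rewrite size_map size_tuple.
  - by rewrite uj.
  exists u'; first by rewrite inE u'E uj.
  by apply/val_inj/(inj_map val_inj); rewrite fE u'E.
(* For [m = 0] the truncated predecessor gives 1 when [j = 0] and 0 otherwise, as the empty vector
   is the only one. *)
case: m => [|m].
  rewrite add0n; case: j jN => [|j] jN.
    rewrite bin0; apply: (etrans _ (card_tuple 0 'I_1)); apply: eq_card => u.
    by rewrite !inE (tuple0 u).
  by rewrite bin_small //; apply: eq_card0 => u; rewrite !inE (tuple0 u).
rewrite addSn /= -bin_sub ?leq_addl // addnK -card_ord_partitions.
apply: eq_card => u; rewrite !inE; congr (_ == _).
by rewrite sumnE big_map.
Qed.

Local Open Scope classical_set_scope.
Local Open Scope ring_scope.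

(** The term [k = n t] has coefficient 1 and is positive; the other terms are nonnegative. *)
Lemma crpF_gt0 (R : realType) (theta : R) (n : nat -> nat) (t : nat) :
  0 < theta -> 0 < crpF theta n t.
Proof.
move=> theta_gt0; rewrite /crpF big_nat_recr //= subnn addn0 bin0 mul1r.
rewrite ltr_wpDl ?exprn_gt0 //; apply: sumr_ge0 => k _.
by rewrite mulr_ge0 ?ler0n // exprn_ge0 // ltW.
Qed.

Lemma sum_pointed (R : nmodType) (T : eqType) (s : seq T) (x : T) (a : R) :
  uniq s -> x \in s -> \sum_(y <- s) (if x == y then a else 0) = a.
Proof.
move=> s_uniq xs; rewrite (bigD1_seq x) //= eqxx big1 ?addr0 // => y /negPf yx.
by rewrite eq_sym yx.
Qed.

(** Each choice leads to exactly one word of [mperms n t.+1], so summing over targets first leaves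
    each choice once, and counting choices for each [k] rebuilds [crpF]. *)
Lemma crp_kernel_total (R : realType) (theta : R) (n : nat -> nat) t w :
  0 < theta -> w \in mperms n t ->
  \sum_(w' <- mperms n t.+1) crp_kernel theta n t.+1 w w' = 1.
Proof.
move=> theta_gt0 wS; have F_gt0 := crpF_gt0 n t.+1 theta_gt0.
rewrite exchange_big /=.
transitivity (\sum_(k < (n t.+1).+1)
  'C((Defs.msum n t + (n t.+1 - k)).-1, n t.+1 - k)%:R * theta ^+ k / crpF theta n t.+1).
  apply: eq_bigr => k _.
  under eq_bigr do rewrite big_mkcondr.
  rewrite exchange_big /= -mulrA.
  transitivity (\sum_(v : (Defs.msum n t).-tuple 'I_(n t.+1).+1 |
      (sumn (map val v) == n t.+1 - k)%N) theta ^+ k / crpF theta n t.+1).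
    apply: eq_bigr => v /eqP vk; rewrite sum_pointed ?permutations_uniq //.
    apply: crp_step_mperms wS _ _; first by rewrite size_map size_tuple.
    by rewrite vk subnK // -ltnS.
  rewrite (sumr_const [pred v : (Defs.msum n t).-tuple 'I_(n t.+1).+1
     | (sumn (map val v) == n t.+1 - k)%N]).
  by rewrite card_bounded_compositions ?leq_subr // mulr_natl.
rewrite -mulr_suml -[RHS](@divff _ (crpF theta n t.+1)) ?gt_eqF //.
by congr (_ / _); rewrite /crpF big_mkord.
Qed.

(** Exactly one word and one choice lead to [w'], so a single term survives; its exponents add up
    because the step adds [k0] cycles. *)
Lemma crp_kernel_balance (R : realType) (theta : R) (n : nat -> nat) t w' :
  w' \in mperms n t.+1 ->
  \sum_(w <- mperms n t) theta ^+ ncycles w * crp_kernel theta n t.+1 w w'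
    = theta ^+ ncycles w' / crpF theta n t.+1.
Proof.
move=> wS'; have [w0 [k0 [v0 [wS0 szv0 sumv0 step0]]]] := crp_step_surj wS'.
have [u0 u0E] : exists u : (Defs.msum n t).-tuple 'I_(n t.+1).+1, map val u = v0.
  by apply: exists_bounded_tuple => //; rewrite -sumv0 leq_addr.
have k0n : (k0 < (n t.+1).+1)%N by rewrite ltnS -sumv0 leq_addl.
have step_eq w k (u : (Defs.msum n t).-tuple 'I_(n t.+1).+1) : w \in mperms n t ->
    crp_step t.+1 k (map val u) w = w' -> [/\ w = w0, k = k0 & u = u0].
  move=> wS; rewrite -step0 => /(crp_step_inj wS wS0) [||-> -> uE] //.
    by rewrite size_map size_tuple.
  by split=> //; apply/val_inj/(inj_map val_inj); rewrite u0E.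
rewrite (bigD1_seq w0) ?permutations_uniq //= [X in _ + X]big1_seq ?addr0; last first.
  move=> w /andP[ww0 wS]; rewrite /crp_kernel big1 ?mulr0 // => k _.
  rewrite big1 // => u /andP[_ /eqP /(step_eq _ _ _ wS)[ww0' _ _]].
  by rewrite ww0' eqxx in ww0.
rewrite /crp_kernel (bigD1 (Ordinal k0n)) //= [X in _ + X]big1 ?addr0; last first.
  move=> k kk0; rewrite big1 // => u /andP[_ /eqP /(step_eq _ _ _ wS0)[_ kk0' _]].
  by rewrite -val_eqE /= kk0' eqxx in kk0.
rewrite (big_pred1 u0) => [|u].
  by rewrite mulrA -exprD -(ncycles_crp_step k0 wS0 szv0) step0.
apply/andP/eqP => [[_ /eqP /(step_eq _ _ _ wS0)[]] //| ->].
by rewrite u0E step0 -sumv0 addnK !eqxx.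
Qed.

Lemma sum_ncycles (R : realType) (theta : R) (n : nat -> nat) t : 0 < theta ->
  \sum_(q <- mperms n t) theta ^+ ncycles q
    = \prod_(1 <= s < t.+1) crpF theta n s.
Proof.
move=> theta_gt0; elim: t => [|t IH].
  rewrite big_geq // (_ : mperms n 0 = [:: [::]]) // big_seq1.
  by rewrite /ncycles (@cyc_prodK [::]).
have F_gt0 := crpF_gt0 n t.+1 theta_gt0.
rewrite big_nat_recr //= -IH.
(* Balance spreads each weight over its predecessors; after the exchange of sums, the kernel out of
   each predecessor has total mass one. *)
transitivity (\sum_(q <- mperms n t.+1) \sum_(w <- mperms n t)
    theta ^+ ncycles w * crp_kernel theta n t.+1 w q * crpF theta n t.+1).
  rewrite big_seq [RHS]big_seq; apply: eq_bigr => q qS.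
  by rewrite -mulr_suml crp_kernel_balance // divfK ?gt_eqF.
rewrite exchange_big /= mulr_suml big_seq [RHS]big_seq; apply: eq_bigr => w wS.
by rewrite -mulr_suml -mulr_sumr crp_kernel_total // mulr1.
Qed.

(** * The law of the process *)

Section Marginals.

Context (R : realType) (theta : R) (n : nat -> nat) (d : measure_display)
  (T : measurableType d) (P : probability T R) (X : nat -> T -> seq nat).
Hypotheses (theta_gt0 : 0 < theta) (X_crp : is_crp theta n P X).

Lemma crp_partition t (A : set T) : measurable A ->
  P A = (\sum_(u <- mperms n t) P (A `&` X t @^-1` [set u]))%E.
Proof.
move=> mA.
have mX u : measurable (A `&` X t @^-1` [set u]).
  by apply: measurableI => //; exact: (crp_measurable X_crp).
(* Additivity is proved along any duplicate-free list; for the list [mperms n t] the range condition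
   makes the membership restriction vacuous. *)
have split_seq s : uniq s ->
    P (A `&` [set o | X t o \in s]) = (\sum_(u <- s) P (A `&` X t @^-1` [set u]))%E
    /\ measurable (A `&` [set o | X t o \in s]).
  elim: s => [|u s IH] /=.
    move=> _; rewrite (_ : _ `&` _ = set0) ?measure0 ?big_nil //.
    by rewrite -subset0 => o [].
  move=> /andP[us /IH[IHs ms]]; rewrite big_cons -IHs.
  have -> : A `&` [set o | X t o \in u :: s]
      = (A `&` X t @^-1` [set u]) `|` (A `&` [set o | X t o \in s]).
    apply/seteqP; split=> o /=.
      by rewrite inE => -[Ao /orP[/eqP ou|os]]; [left|right].
    by rewrite inE => -[[Ao ->]|[Ao ->]]; rewrite ?eqxx ?orbT.
  split; last exact: measurableU.
  rewrite measureU //; rewrite -subset0 => o [[_ /= ->] [_ /=]].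
  by rewrite (negPf us).
have [<- _] := split_seq _ (permutations_uniq (Defs.mset n t)).
by congr (P _); apply/esym/setIidl => o _; exact: (crp_range X_crp).
Qed.

Lemma measurable_window j t (h : nat -> seq nat) :
  measurable [set o | forall s, (j <= s <= t)%N -> X s o = h s].
Proof.
apply: (bigcap_measurableType
  (F := fun s => X s @^-1` [set h s]) (P := [set s | (j <= s <= t)%N])).
by move=> s _; exact: (crp_measurable X_crp).
Qed.

(* Summing the Markov property over the values of [X 0], ..., [X j.-1] forgets
   the history before time [j]. *)
Lemma crp_markov_window j t (h : nat -> seq nat) (w : seq nat) : (j <= t)%N ->
  P [set o | (forall s, (j <= s <= t)%N -> X s o = h s) /\ X t.+1 o = w] =
  (P [set o | forall s, (j <= s <= t)%N -> X s o = h s]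
     * (crp_kernel theta n t.+1 (h t) w)%:E)%E.
Proof.
elim: j h => [|j IH] h jt; first exact: (crp_markov X_crp).
pose A := [set o | forall s, (j < s <= t)%N -> X s o = h s].
have mA : measurable A by exact: measurable_window.
pose B := A `&` X t.+1 @^-1` [set w].
have mB : measurable B.
  by apply: measurableI => //; exact: (crp_measurable X_crp).
rewrite -/B -/A (crp_partition j mA) (crp_partition j mB).
rewrite ge0_sume_distrl //; apply: eq_bigr => u _.
(* [hu] prescribes [u] at time [j] as well, so the induction hypothesis applies to the window
   starting at [j]; as [j < t], the value at [t] is unchanged. *)
pose hu s := if s == j then u else h s.
have AE : A `&` X j @^-1` [set u]
    = [set o | forall s, (j <= s <= t)%N -> X s o = hu s].
  apply/seteqP; split=> o /=.
    move=> [Ao ou] s /andP[js st]; rewrite /hu.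
    case: eqP js => [->|/eqP sj js] //; apply: Ao.
    by rewrite st ltn_neqAle eq_sym sj js.
  move=> Ao; split=> [s /andP[js st]|]; rewrite Ao /hu.
  - by rewrite gtn_eqF.
  - by rewrite (ltnW js) st.
  - by rewrite eqxx.
  - by rewrite leqnn ltnW.
rewrite AE.
have -> : h t = hu t by rewrite /hu gtn_eqF.
rewrite -(IH hu) ?(ltnW jt) //; congr (P _).
by rewrite /B setIAC AE.
Qed.

(** Total probability over [X t], with the Markov property on the window consisting of the time [t]
    alone. *)
Lemma crp_marginalS t w :
  P (X t.+1 @^-1` [set w]) =
  (\sum_(u <- mperms n t)
     P (X t @^-1` [set u]) * (crp_kernel theta n t.+1 u w)%:E)%E.
Proof.
rewrite (crp_partition t); last exact: (crp_measurable X_crp).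
apply: eq_bigr => u _.
have := @crp_markov_window t t (fun=> u) w (leqnn t).
have -> : [set o | forall s, (t <= s <= t)%N -> X s o = u] = X t @^-1` [set u].
  apply/seteqP; split=> o /= Xo; first by apply: Xo; rewrite leqnn.
  by move=> s; rewrite -eqn_leq => /eqP <-.
move=> <-; congr (P _); apply/seteqP; split=> o /=.
  by move=> [-> ou]; split=> // s; rewrite -eqn_leq => /eqP <-.
by move=> [Xo ->]; split=> //; apply: Xo; rewrite leqnn.
Qed.

Lemma crp_marginal t p : p \in mperms n t ->
  P (X t @^-1` [set p])
    = (theta ^+ ncycles p / \prod_(1 <= s < t.+1) crpF theta n s)%:E.
Proof.
elim: t p => [|t IH] p.
  rewrite (_ : mperms n 0 = [:: [::]]) // inE => /eqP ->.
  rewrite big_geq // divr1 /ncycles (@cyc_prodK [::]) // expr0.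
  rewrite (_ : _ @^-1` _ = setT) ?probability_setT //.
  by apply/seteqP; split=> o _ //=; exact: (crp_init X_crp).
move=> pS; rewrite crp_marginalS.
have F_gt0 := crpF_gt0 n t.+1 theta_gt0.
transitivity (\sum_(u <- mperms n t) ((theta ^+ ncycles u * crp_kernel theta n t.+1 u p)
    / \prod_(1 <= s < t.+1) crpF theta n s)%:E)%E.
  rewrite big_seq [RHS]big_seq; apply: eq_bigr => u uS.
  by rewrite IH // -EFinM mulrAC.
(* The balance identity supplies the last factor [crpF theta n t.+1] of the denominator. *)
rewrite sumEFin -mulr_suml crp_kernel_balance //.
by rewrite [in RHS]big_nat_recr //= invfM mulrA mulrAC.
Qed.

End Marginals.

Theorem theorem2 (R : realType) (theta : R) (theta_gt0 : 0 < theta)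
    (n : nat -> nat) (n_ge1 : forall i, (1 <= i)%N -> (1 <= n i)%N)
    (t : nat) (t_ge1 : (1 <= t)%N) :
  (forall (d : measure_display) (T : measurableType d) (P : probability T R)
      (X : nat -> T -> seq nat), is_crp theta n P X ->
    forall p : seq nat, p \in mperms n t ->
      P (X t @^-1` [set p]) =
        (theta ^+ ncycles p / \sum_(q <- mperms n t) theta ^+ ncycles q)%:E)
  /\ \sum_(q <- mperms n t) theta ^+ ncycles q =
       \prod_(1 <= s < t.+1) crpF theta n s.
Proof.
split; last exact: sum_ncycles.
move=> d T P X X_crp p pS.
by rewrite sum_ncycles // (crp_marginal theta_gt0 X_crp pS).
Qed.
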